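(* Let $m \in \mathbb{N}$ with $m \geq 2$. Let $\mathcal{A} : M_n(\mathbb{C}) \to M_n(\mathbb{C})$ be given by $$\mathcal{A}(X) = -A_1 X B_1 + \sum_{i=2}^m A_i X B_i$$ with $A_i, B_i \in M_n(\mathbb{C})$ positive for $i = 1, \dots, m$. If there exist positive numbers $\xi_k$, for $k = 2, 3, \dots, m$, such that $$-A_1 + \sum_{k=2}^m \xi_k A_k$$ is positive and $B_k - \xi_k B_1$ is positive for all $k = 2, 3, \dots, m$, then there exist positive matrices $A_i', B_i' \in M_n(\mathbb{C})$, $i = 1, \dots, m$, such that $$\mathcal{A}(X) = \sum_{i=1}^m A_i' X B_i'$$ for all $X \in M_n(\mathbb{C})$.
   Context: $M_n(\mathbb{C})$ is the space of $n \times n$ complex matrices. A matrix $A \in M_n(\mathbb{C})$ is called positive if $x^* A x > 0$ for all nonzero $x \in \mathbb{C}^n$ (equivalently, $A$ is Hermitian and all its eigenvalues are strictly positive). *)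

(* Defs.v *)
From HB Require Import structures.
From mathcomp Require Import all_boot all_order all_algebra.
From mathcomp Require Import reals.
From mathcomp.real_closed Require Import complex.

Set Implicit Arguments.
Unset Strict Implicit.
Unset Printing Implicit Defensive.

Import Order.TTheory GRing.Theory Num.Theory.

Local Open Scope ring_scope.
Local Open Scope sesquilinear_scope.
Local Open Scope complex_scope.

(* The order on R[i] is partial: 0 < z means that z is real and positive.
   The condition therefore forces M to be Hermitian. *)
Definition positive_mx (R : realType) (n : nat) (M : 'M[R[i]]_n) : Prop :=
  forall x : 'cV[R[i]]_n, x != 0 -> 0 < (x^t* *m M *m x) 0 0.

(* Main.v *)
Require Import Defs.
From HB Require Import structures.
From mathcomp Require Import all_boot all_order all_algebra.
From mathcomp Require Import reals.
From mathcomp.real_closed Require Import complex.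

Set Implicit Arguments.
Unset Strict Implicit.
Unset Printing Implicit Defensive.

Import Order.TTheory GRing.Theory Num.Theory.

Local Open Scope ring_scope.
Local Open Scope complex_scope.

(** Each B k splits as (B k - xi k B 1) + xi k B 1. Moving the scalar xi k
    across the product A k X B 1 and collecting all the terms
    ending in B 1, the negative term is absorbed:
      cA X = (- A 1 + \sum_k xi k A k) X B 1 + \sum_k A k X (B k - xi k B 1),
    and the hypotheses say exactly that the new coefficients are positive. *)
Theorem theorem4p6 (R : realType) (n m : nat) (hm : (2 <= m)%N)
    (A B : nat -> 'M[R[i]]_n) (cA : 'M[R[i]]_n -> 'M[R[i]]_n)
    (hA : forall i : nat, (1 <= i <= m)%N -> positive_mx (A i))
    (hB : forall i : nat, (1 <= i <= m)%N -> positive_mx (B i))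
    (hcA : forall X : 'M[R[i]]_n,
       cA X = - (A 1%N *m X *m B 1%N)
              + \sum_(2 <= i < m.+1) A i *m X *m B i) :
  (exists xi : nat -> R,
     [/\ forall k : nat, (2 <= k <= m)%N -> 0 < xi k,
         positive_mx (- A 1%N + \sum_(2 <= k < m.+1) (xi k)%:C *: A k)
       & forall k : nat, (2 <= k <= m)%N ->
           positive_mx (B k - (xi k)%:C *: B 1%N)]) ->
  exists A' B' : nat -> 'M[R[i]]_n,
    [/\ forall i : nat, (1 <= i <= m)%N -> positive_mx (A' i),
        forall i : nat, (1 <= i <= m)%N -> positive_mx (B' i)
      & forall X : 'M[R[i]]_n,
          cA X = \sum_(1 <= i < m.+1) A' i *m X *m B' i].
Proof.
case=> xi [_ posA1 posB].
exists (fun i => if i == 1%N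
                 then - A 1%N + \sum_(2 <= k < m.+1) (xi k)%:C *: A k
                 else A i).
exists (fun i => if i == 1%N then B 1%N else B i - (xi i)%:C *: B 1%N).
split=> [i /andP[i_gt0 le_im] | i /andP[i_gt0 le_im] | X].
- by case: eqP => // _; apply: hA; rewrite i_gt0.
- case: eqP => [_ | /eqP i_neq1]; first by apply: hB; rewrite /= ltnW.
  by apply: posB; rewrite ltn_neqAle eq_sym i_neq1 i_gt0.
rewrite hcA [RHS]big_ltn ?ltnS ?(ltnW hm) //= !mulmxDl !mulNmx !mulmx_suml -addrA -big_split /=.
congr (_ + _); apply: eq_big_nat => k /andP[k_ge2 _].
rewrite (gtn_eqF k_ge2) mulmxBr -!scalemxAl -scalemxAr.
by rewrite addrC subrK.
Qed.
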